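(* Let $\vec{G}=(\mathcal{V},\vec{\mathcal{E}})$ be a directed acyclic graph with $n$ vertices such that the longest directed path in $\vec{G}$ has length $\ell$. Then $\vec{G}$ has at most $t(n,\ell+1)$ edges.
   Context: A directed acyclic graph (DAG) is a simple directed graph without directed cycles. A directed path is a sequence of vertices $v_0,\dots,v_k$ such that $(v_{i-1},v_i)$ is a directed edge for every $1\le i\le k$; its length is $k$ (the number of edges). $t(n,m)$ denotes the number of edges of the $m$-partite Turán graph on $n$ vertices, i.e. the complete $m$-partite graph on $n$ vertices whose part sizes differ pairwise by at most one. *)

(* Defs.v *)
From mathcomp Require Import all_boot.

Set Implicit Arguments.
Unset Strict Implicit.
Unset Printing Implicit Defensive.

Section Digraph.
Variables (T : finType) (e : rel T).

Definition arcs : {set T * T} := [set p | e p.1 p.2].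

(* [ucycle e c] holds of the empty sequence, which is not a directed cycle. *)
Definition dag : Prop :=
  irreflexive e /\ (forall c : seq T, ucycle e c -> c = [::]).

(* [path e x p] says that x :: p is a directed path; it has [size p] edges.   *)
Definition longest_path_length (l : nat) : Prop :=
  (exists (x : T) (p : seq T), path e x p /\ size p = l) /\
  (forall (x : T) (p : seq T), path e x p -> size p <= l).

End Digraph.

(* Edges of an undirected graph g (symmetric and irreflexive), as 2-subsets.  *)
Definition edges (T : finType) (g : rel T) : {set {set T}} :=
  [set [set p.1; p.2] | p : T * T & g p.1 p.2].

Definition is_turan_graph (m : nat) (T : finType) (g : rel T) : Prop :=
  exists part : T -> 'I_m,
    (forall x y, g x y = (part x != part y)) /\
    (forall i j, #|[set x | part x == i]| <= #|[set x | part x == j]|.+1).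

(* For 0 < m, the parts are the residue classes modulo m, see                 *)
(* [turan_graphP]. (For m = 0 the definition is junk.)                        *)
Definition turan_graph (n m : nat) : rel 'I_n :=
  fun x y => x %% m != y %% m.

Definition turan_number (n m : nat) : nat := #|edges (@turan_graph n m)|.

Lemma card_residue_class (n m i : nat) : i < m ->
  #|[set x : 'I_n | x %% m == i]| = n %/ m + (i < n %% m).
Proof.
move=> im; have m0 : 0 < m by apply: leq_ltn_trans im.
rewrite -sum1dep_card big_mkcond /=.
elim: n => [|n IHn]; first by rewrite big_ord0 div0n mod0n.
rewrite big_ord_recr /= IHn divnS // modnS.
have rm := ltn_pmod n m0.
case: (boolP (m %| n.+1)) => [dv|_] /=; last first.
  rewrite ltnS (leq_eqVlt i) eq_sym add0n.
  by case: ltngtP; rewrite /= ?addn0 ?add0n.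
have rE : (n %% m).+1 = m.
  apply/eqP; rewrite eqn_leq rm dvdn_leq //.
  by rewrite /dvdn -addn1 modnDml addn1.
move: im; rewrite -{1}rE ltnS leq_eqVlt eq_sym.
by case: ltngtP; rewrite //= !addn0 addnC.
Qed.

Lemma turan_graphP (n m : nat) : 0 < m -> is_turan_graph m (@turan_graph n m).
Proof.
move=> m0; exists (fun x : 'I_n => Ordinal (ltn_pmod x m0)); split=> // i j.
have cE (k : 'I_m) : #|[set x : 'I_n | Ordinal (ltn_pmod x m0) == k]| =
    n %/ m + (k < n %% m) by rewrite -(card_residue_class n (ltn_ord k)).
by rewrite !cE -addnS leq_add2l; case: (i < _).
Qed.

(* Main.v *)
Require Import Defs.
From mathcomp Require Import all_boot.
From mathcomp Require Import zify.

Set Implicit Arguments.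
Unset Strict Implicit.
Unset Printing Implicit Defensive.

(** Colour each vertex x by the length of a longest directed path that starts
    at x.  Prepending an arc to a path shows that colours strictly decrease
    along arcs ([level_arc]), so the l + 1 colour classes contain no arc inside
    them, and no two arcs are opposite.  Hence twice the number of arcs is at
    most the number of ordered pairs of vertices of distinct colours, which is
    n ^ 2 - \sum_i a_i ^ 2 for classes of sizes a_i ([card_bichromaticD]).
    For the Turan graph, twice the number of edges is at least this count for
    the residue classes modulo l + 1 ([card_rel_le_edges]), whose sizes differ
    by at most one.  A sum of squares with a given number of terms and a given
    total is least when the terms are balanced ([bichromatic_max]). *)

Section Coloring.
Variables (T : finType) (m : nat) (f : T -> 'I_m).

Definition color_class (i : 'I_m) : {set T} := [set x | f x == i].

Definition bichromatic : {set T * T} := [set p | f p.1 != f p.2].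

Lemma sum_card_color_class : \sum_i #|color_class i| = #|T|.
Proof.
rewrite -sum1_card (partition_big f predT) //=.
by apply: eq_bigr => i _; rewrite -sum1dep_card.
Qed.

(** The complement of the bichromatic pairs is the disjoint union of the squares
    of the colour classes. *)
Lemma card_bichromaticD :
  #|bichromatic| + \sum_i #|color_class i| ^ 2 = #|T| ^ 2.
Proof.
have -> : \sum_i #|color_class i| ^ 2 = #|~: bichromatic|.
  rewrite -[RHS]sum1_card (partition_big (fun p => f p.1) predT) //=.
  apply: eq_bigr => i _; rewrite -mulnn -cardsX -sum1_card.
  apply: eq_bigl => -[x y]; rewrite !inE /= negbK.
  by have [<-|] := eqVneq (f x) i; rewrite /= ?andbT ?andbF // eq_sym.
by rewrite cardsC card_prod mulnn.
Qed.

End Coloring.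

(** The right-hand side minus the left-hand side is (a - q) (a - (q + 1)), a
    product of two consecutive integers, hence nonnegative.  This replaces
    convexity: it bounds a ^ 2 below by an affine function of a, whose sum over
    the classes depends on their total size only. *)
Lemma sqr_tangent (q a : nat) : (q + q.+1) * a <= a ^ 2 + q * q.+1.
Proof.
have [/subnKC<-|/subnKC<-] := leqP a q; nia.
Qed.

Lemma sqr_tangent_eq (q : nat) (b : bool) :
  (q + q.+1) * (q + b) = (q + b) ^ 2 + q * q.+1.
Proof. by case: b; rewrite /=; nia. Qed.

(** Both sums of squares are compared with the same sum of the affine bound of
    [sqr_tangent], which is exact on the class sizes q and q + 1. *)
Lemma bichromatic_max (S T : finType) (m q : nat) (f : S -> 'I_m)
    (g : T -> 'I_m) (r : 'I_m -> bool) :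
  #|S| = #|T| -> (forall i, #|color_class g i| = q + r i) ->
  #|bichromatic f| <= #|bichromatic g|.
Proof.
move=> eqST card_g.
have lef : (q + q.+1) * #|S| <=
    \sum_i #|color_class f i| ^ 2 + \sum_(i < m) q * q.+1.
  rewrite -(sum_card_color_class f) big_distrr -big_split /=.
  by apply: leq_sum => i _; apply: sqr_tangent.
have eqg : (q + q.+1) * #|T| =
    \sum_i #|color_class g i| ^ 2 + \sum_(i < m) q * q.+1.
  rewrite -(sum_card_color_class g) big_distrr -big_split /=.
  by apply: eq_bigr => i _; rewrite card_g sqr_tangent_eq.
have := card_bichromaticD f; have := card_bichromaticD g.
by move: lef; rewrite eqST eqg; lia.
Qed.

(** An unordered pair {x, y} comes from at most the two ordered pairs (x, y)
    and (y, x). *)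
Lemma card_rel_le_edges (T : finType) (g : rel T) :
  #|[set p | g p.1 p.2]| <= 2 * #|edges g|.
Proof.
set A := [set p | _]; set h := fun p : T * T => [set p.1; p.2].
rewrite -[edges g]/(h @: A).
rewrite -sum1_card (partition_big_imset h) /= mulnC -sum_nat_const.
apply: leq_sum => _ /imsetP[[x y] _ ->]; rewrite sum1dep_card.
apply: leq_trans (_ : #|[set (x, y); (y, x)]| <= 2); last first.
  by rewrite cards2; case: (_ != _).
apply/subset_leq_card/subsetP => -[u v]; rewrite !inE /= => /andP[_ /eqP E].
(* {u, v} = {x, y}: each of u, v is one of x, y, and conversely. *)
have := set21 u v; have := set22 u v; have := set21 x y; have := set22 x y.
move: E; rewrite /h /= => E.
rewrite -{1 2}E {3 4}E !inE !xpair_eqE.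
by do 4!(case/orP => /eqP ?); subst; rewrite ?eqxx ?orbT.
Qed.

(** An arc and its reverse are both bichromatic, and monotonicity makes the
    arcs disjoint from their reverses. *)
Lemma card_arcs_le_bichromatic (T : finType) (e : rel T) (m : nat)
    (f : T -> 'I_m) :
  (forall x y, e x y -> f y < f x) -> 2 * #|arcs e| <= #|bichromatic f|.
Proof.
move=> fe; pose swap (p : T * T) := (p.2, p.1).
have swapK : involutive swap by case.
rewrite mul2n -addnn -{2}(card_imset (mem (arcs e)) (inv_inj swapK)).
have dis : arcs e :&: swap @: arcs e = set0.
  apply/setP => -[x y]; rewrite !inE /=; apply/negP => /andP[/fe lt_yx].
  case/imsetP => -[u v]; rewrite inE /= => /fe lt_vu [xv yu].
  by move: lt_vu; rewrite -xv -yu ltnNge ltnW.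
rewrite -cardsUI dis cards0 addn0; apply: subset_leq_card.
apply/subsetP => -[x y]; rewrite !inE /= -val_eqE /=.
case/orP => [/fe|/imsetP[[u v]]]; first by rewrite neq_ltn orbC => ->.
by rewrite inE /= => /fe lt_vu [-> ->]; rewrite neq_ltn lt_vu.
Qed.

(** Only lengths up to l are searched, so that the value can serve as one of
    l + 1 colours; it is the length of a longest directed path from x as soon
    as l bounds the length of every path. *)
Definition level (T : finType) (e : rel T) (l : nat) (x : T) : 'I_l.+1 :=
  [arg max_(k > ord0 | [exists t : k.-tuple T, path e x t]) k].

(** Prepending x to a longest path from y gives a path from x with one more arc,
    and the bound l makes its length one of those that [level] searches. *)
Lemma level_arc (T : finType) (e : rel T) (l : nat) (x y : T) :
  (forall z p, path e z p -> size p <= l) -> e x y ->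
  level e l y < level e l x.
Proof.
move=> le_l exy.
have P0 z : [exists t : (@ord0 l).-tuple T, path e z t].
  by apply/existsP; exists [tuple].
rewrite {1}/level; case: arg_maxnP => // i /existsP[t yt] _.
rewrite /level; case: arg_maxnP => // j _ max_j.
have xyt : path e x (y :: t) by rewrite /= exy.
have := le_l _ _ xyt; rewrite /= size_tuple => lt_il.
by apply: (max_j (Ordinal (lt_il : i.+1 < l.+1))); apply/existsP;
  exists [tuple of y :: t].
Qed.

Theorem proposition2p5 (T : finType) (e : rel T) (n l : nat)
    (e_dag : dag e) (card_T : #|T| = n) (e_longest : longest_path_length e l) :
  #|arcs e| <= turan_number n l.+1.
Proof.
have [_ le_l] := e_longest.
pose res (x : 'I_n) := Ordinal (ltn_pmod x (ltn0Sn l)).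
have card_res (i : 'I_l.+1) :
    #|color_class res i| = n %/ l.+1 + (i < n %% l.+1).
  by rewrite -(card_residue_class n (ltn_ord i)).
rewrite -(leq_pmul2l (isT : 0 < 2)).
apply: leq_trans (card_rel_le_edges _).
apply: leq_trans (card_arcs_le_bichromatic (fun x y => level_arc le_l)) _.
by apply: bichromatic_max card_res; rewrite card_T card_ord.
Qed.
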